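(* Let $N\ge2$, $g=sl(N)$ over $\mathbb{C}$, and let $h,\xi\in\mathbb{C}$ with $h\ne0$. Let $\mu^*_{h;0}$ be the Lie multiplication on $g^*$ dual to the standard Lie bialgebra structure on $g$ given by the classical $r$-matrix $r_{h;0}$, let $g^*_{h;0}=(g^*,\mu^*_{h;0})$ be the resulting standard dual Lie algebra, and let $\mu^*_{0;\xi}:g^*\wedge g^*\to g^*$ be the multiplication on $g^*$ dual to the jordanian Lie bialgebra structure given by the classical $r$-matrix $r_{0;\xi}$. Then $\mu^*_{0;\xi}$, viewed by duality as a map $g\to g\wedge g$, is a 1-cocycle, $\mu^*_{0;\xi}\in Z^1(g,g\wedge g)$, and at the same time $\mu^*_{0;\xi}$ is a 2-coboundary of the standard dual Lie algebra with coefficients in its adjoint representation, $\mu^*_{0;\xi}\in B^2(g^*_{h;0},g^*_{h;0})$.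
   Context: With $E_{ij}$ the matrix units, $H_{k,l}=E_{kk}-E_{ll}$ (so $H_{1N}=E_{11}-E_{NN}$) and $a\wedge b=a\otimes b-b\otimes a$: $$\begin{aligned}r_{h;0}=\ &\frac hN\Big(\sum_{k=1}^{N-1}k(N-k)H_{k,k+1}\otimes H_{k,k+1}+\sum_{k<l}(N-l)k\,(H_{k,k+1}\otimes H_{l,l+1}+H_{l,l+1}\otimes H_{k,k+1})\Big)\\&+2h\sum_{k<l}E_{lk}\otimes E_{kl},\end{aligned}$$ where in the second sum $1\le k<l\le N-1$ and in the third $1\le k<l\le N$, and $$r_{0;\xi}=-\xi\Big(H_{1N}\wedge E_{1N}+2\sum_{k=2}^{N-1}E_{1k}\wedge E_{kN}\Big).$$ A classical $r$-matrix $r\in g\otimes g$ gives the cobracket $\delta_r(a)=[a\otimes1+1\otimes a,\,r]\in g\wedge g$, and the dual multiplication $\mu^*:g^*\wedge g^*\to g^*$ is $\langle\mu^*(f_1,f_2),a\rangle=\langle f_1\otimes f_2,\delta_r(a)\rangle$. $Z^1(g,g\wedge g)$ denotes Lie algebra 1-cocycles with $g$ acting on $g\wedge g$ by the extended adjoint action; $B^2(\mathfrak a,\mathfrak a)$ denotes Chevalley–Eilenberg 2-coboundaries of the Lie algebra $\mathfrak a$ with adjoint coefficients. *)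

(* Defs.v *)
From HB Require Import structures.
From mathcomp Require Import all_boot all_order all_algebra.
From mathcomp Require Import ring.
From mathcomp Require Export reals complex.

Set Implicit Arguments.
Unset Strict Implicit.
Unset Printing Implicit Defensive.

Import GRing.Theory.
Local Open Scope ring_scope.

(* [linfun f] is only meaningful when [f] is linear, and [bilin f] when [f] is
   bilinear; the evaluation lemmas below certify this for every use. *)
Lemma linfun_linE (F : fieldType) (U V : vectType F) (f : U -> V) :
  linear f -> linfun f =1 f.
Proof.
move=> lf u; pose mL := GRing.isLinear.Build F U V *:%R f lf.
pose fL : {linear U -> V} := HB.pack f mL.
exact: (lfunE fL u).
Qed.

Definition bilin (F : fieldType) (U V W : vectType F) (f : U -> V -> W) :
    'Hom(U, 'Hom(V, W)) :=
  linfun (fun u => linfun (f u)).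

Lemma bilinE (F : fieldType) (U V W : vectType F) (f : U -> V -> W) :
  (forall u, linear (f u)) -> (forall v, linear (f^~ v)) ->
  forall u v, bilin f u v = f u v.
Proof.
move=> lr ll u v; rewrite /bilin linfun_linE ?linfun_linE // => a x y.
apply/lfunP => w.
by rewrite add_lfunE scale_lfunE !linfun_linE // (ll w a x y).
Qed.

Section Tensor.
Variables (F : fieldType) (V : vectType F).

Definition dual : vectType F := 'Hom(V, F^o).

(* V (x) V for finite-dimensional V, as the bilinear forms on the dual:
   [t f k] is the pairing <f (x) k, t>. *)
Definition tensor : vectType F := 'Hom(dual, 'Hom(dual, F^o)).

Definition tens (v w : V) : tensor :=
  bilin (fun f k : dual => (f v : F^o) * (k w : F^o)).

Lemma tensE (v w : V) (f k : dual) : tens v w f k = f v * k w.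
Proof.
rewrite bilinE // => [g|g] a x y /=; rewrite add_lfunE scale_lfunE.
  by rewrite mulrDr -scalerAr.
by rewrite mulrDl -scalerAl.
Qed.

Definition wedge (v w : V) : tensor := tens v w - tens w v.

(* Membership in V /\ V, the subspace of V (x) V spanned by the [wedge v w]. *)
Definition in_wedge (t : tensor) : Prop :=
  exists s : seq (V * V), t = \sum_(p <- s) wedge p.1 p.2.

Lemma in_wedge_alt (t : tensor) (f : dual) : in_wedge t -> t f f = 0.
Proof.
case=> s ->; rewrite !sum_lfunE big1 // => p _.
by rewrite !(add_lfunE, opp_lfunE) !tensE mulrC subrr.
Qed.

(* A (x) B acting on V (x) V. *)
Definition tmap (A B : 'End(V)) (t : tensor) : tensor :=
  bilin (fun f k : dual => t (f \o A)%VF (k \o B)%VF).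

Lemma tmapE (A B : 'End(V)) (t : tensor) (f k : dual) :
  tmap A B t f k = t (f \o A)%VF (k \o B)%VF.
Proof.
rewrite bilinE // => [g|g] a x y /=.
  by rewrite comp_lfunDl -comp_lfunZl linearP.
by rewrite comp_lfunDl -comp_lfunZl linearP add_lfunE scale_lfunE.
Qed.

Lemma tmap_tens (A B : 'End(V)) (v w : V) :
  tmap A B (tens v w) = tens (A v) (B w).
Proof.
by apply/lfunP=> f; apply/lfunP=> k; rewrite tmapE !tensE !comp_lfunE.
Qed.

Lemma tmap_linear (A B : 'End(V)) : linear (tmap A B).
Proof.
move=> a s t; apply/lfunP=> f; apply/lfunP=> k.
by rewrite !(tmapE, add_lfunE, scale_lfunE).
Qed.

End Tensor.

Section Lie.
Variables (F : fieldType) (V : vectType F).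

Definition mult : vectType F := 'Hom(V, 'Hom(V, V)).

Definition lie_mult (m : mult) : Prop :=
  (forall x, m x x = 0) /\
  (forall x y z, m x (m y z) + m y (m z x) + m z (m x y) = 0).

(* The extended adjoint action [a (x) 1 + 1 (x) a, t]. *)
Definition ad2 (m : mult) (a : V) (t : tensor V) : tensor V :=
  tmap (m a) \1%VF t + tmap \1%VF (m a) t.

Lemma ad2_tens (m : mult) (a v w : V) :
  ad2 m a (tens v w) = tens (m a v) w + tens v (m a w).
Proof. by rewrite /ad2 !tmap_tens !id_lfunE. Qed.

Lemma ad2E (m : mult) (a : V) (t : tensor V) (f k : dual V) :
  ad2 m a t f k = t (f \o m a)%VF k + t f (k \o m a)%VF.
Proof. by rewrite /ad2 !add_lfunE !tmapE !comp_lfun1r. Qed.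

Definition cobracket (m : mult) (r : tensor V) : 'Hom(V, tensor V) :=
  linfun (fun a => ad2 m a r).

Lemma cobracketE (m : mult) (r : tensor V) (a : V) :
  cobracket m r a = ad2 m a r.
Proof.
rewrite linfun_linE // => c x y; apply/lfunP=> f; apply/lfunP=> k.
rewrite !(ad2E, add_lfunE, scale_lfunE) linearP /= !comp_lfunDr -!comp_lfunZr.
rewrite !linearP add_lfunE scale_lfunE.
by rewrite scalerDr addrACA.
Qed.

(* 1-cocycles of (V, m) with values in V /\ V. *)
Definition cocycle1 (m : mult) (d : 'Hom(V, tensor V)) : Prop :=
  (forall a, in_wedge (d a)) /\
  (forall a b, d (m a b) = ad2 m a (d b) - ad2 m b (d a)).

(* Chevalley-Eilenberg 2-coboundaries of (V, m) with adjoint coefficients. *)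
Definition coboundary2 (m psi : mult) : Prop :=
  exists phi : 'End(V), forall x y,
    psi x y = m x (phi y) - m y (phi x) - phi (m x y).

End Lie.

Section Duality.
Variables (F : fieldType) (V : vectType F).

Definition dual_mult (d : 'Hom(V, tensor V)) : mult (dual V) :=
  bilin (fun f k : dual V => linfun (fun a => d a f k) : dual V).

Lemma dual_multE (d : 'Hom(V, tensor V)) (f k : dual V) (a : V) :
  dual_mult d f k a = d a f k.
Proof.
have lin_d g l : linear (fun a => d a g l).
  by move=> c x y; rewrite linearP !(add_lfunE, scale_lfunE).
rewrite bilinE ?linfun_linE // => [g|g] c x y; apply/lfunP=> b;
  rewrite add_lfunE scale_lfunE !linfun_linE //.
  by rewrite linearP.
by rewrite linearP add_lfunE scale_lfunE.
Qed.

(* A multiplication on the dual of V, viewed by duality as a map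
   V -> V (x) V. *)
Definition codual (m : mult (dual V)) : 'Hom(V, tensor V) :=
  linfun (fun a => bilin (fun f k : dual V => m f k a)).

Lemma codualE (m : mult (dual V)) (a : V) (f k : dual V) :
  codual m a f k = m f k a.
Proof.
have bE b g l : bilin (fun f k : dual V => m f k b) g l = m g l b.
  rewrite bilinE // => [u|u] c x y; rewrite linearP !(add_lfunE, scale_lfunE) //.
rewrite linfun_linE ?bE // => c x y; apply/lfunP=> g; apply/lfunP=> l.
by rewrite !(add_lfunE, scale_lfunE) !bE linearP.
Qed.

Lemma dual_multK : cancel dual_mult codual.
Proof.
move=> d; apply/lfunP=> a; apply/lfunP=> f; apply/lfunP=> k.
by rewrite codualE dual_multE.
Qed.

End Duality.

Section SpecialLinear.
Variables (F : fieldType) (N : nat).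

Definition sl_space : {vspace 'M[F]_N} :=
  lker (linfun (fun A : 'M[F]_N => \tr A : F^o)).

Definition sl : vectType F := subvs_of sl_space.

Lemma mem_sl (A : 'M[F]_N) : (A \in sl_space) = (\tr A == 0).
Proof.
rewrite memv_ker linfun_linE // => a B C.
by rewrite linearD linearZ.
Qed.

(* [vsproj] restricts to the identity on [sl_space]; [to_sl] is applied to
   traceless matrices only. *)
Definition to_sl (A : 'M[F]_N) : sl := vsproj sl_space A.

Lemma to_slK (A : 'M[F]_N) : \tr A = 0 -> vsval (to_sl A) = A.
Proof. by move=> trA; rewrite vsprojK // mem_sl trA. Qed.

Definition sl_br : mult sl :=
  bilin (fun a b : sl => to_sl (vsval a *m vsval b - vsval b *m vsval a)).

Lemma sl_brE (a b : sl) :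
  vsval (sl_br a b) = vsval a *m vsval b - vsval b *m vsval a.
Proof.
rewrite bilinE ?to_slK //.
- by rewrite linearB /= mxtrace_mulC subrr.
- move=> u c x y; rewrite /to_sl -linearP; congr (vsproj _ _).
  rewrite [vsval (_ + _)]linearP mulmxDr mulmxDl -scalemxAr -scalemxAl.
  by rewrite scalerBr opprD addrACA.
- move=> u c x y; rewrite /to_sl -linearP; congr (vsproj _ _).
  rewrite [vsval (_ + _)]linearP mulmxDr mulmxDl -scalemxAr -scalemxAl.
  by rewrite scalerBr opprD addrACA.
Qed.

Lemma sl_br_lie : lie_mult sl_br.
Proof.
split=> [x|x y z]; apply/val_inj; first by rewrite /= sl_brE subrr.
rewrite /= !sl_brE !(mulmxBr, mulmxBl) !mulmxA.
set a := _ *m _ *m _; set b := _ *m _ *m _; set c := _ *m _ *m _.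
set d := _ *m _ *m _; set e := _ *m _ *m _; set f := _ *m _ *m _.
clearbody a b c d e f.
by apply/matrixP=> i j; rewrite !mxE; ring.
Qed.

(* Indices run over 1..N, whereas matrix entries are indexed by 0..N-1. *)
Definition Emx (i j : nat) : 'M[F]_N :=
  \matrix_(a < N, b < N) ((a.+1 == i) && (b.+1 == j))%:R.

Definition E (i j : nat) : sl := to_sl (Emx i j).
Definition H (k l : nat) : sl := to_sl (Emx k k - Emx l l).

Lemma E_val (i j : nat) : i != j -> vsval (E i j) = Emx i j.
Proof.
move=> nij; rewrite to_slK // /mxtrace big1 // => a _; rewrite mxE.
by case: eqP => //= ->; rewrite (negPf nij).
Qed.

Lemma H_val (k l : nat) :
  (0 < k <= N)%N -> (0 < l <= N)%N -> vsval (H k l) = Emx k k - Emx l l.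
Proof.
have trE i : (0 < i <= N)%N -> \tr (Emx i i) = 1.
  case: i => // i iN; rewrite /mxtrace (bigD1 (Ordinal iN)) //= mxE /= eqxx.
  rewrite big1 ?addr0 // => j nj; rewrite mxE andbb eqSS.
  by have /negPf-> : (j : nat) != i by [].
by move=> kN lN; rewrite to_slK // linearB /= !trE // subrr.
Qed.

Definition r_std (h : F) : tensor sl :=
  (h / N%:R) *:
    (\sum_(1 <= k < N) (k * (N - k))%:R *: tens (H k k.+1) (H k k.+1)
     + \sum_(1 <= k < N) \sum_(k.+1 <= l < N)
         ((N - l) * k)%:R *:
           (tens (H k k.+1) (H l l.+1) + tens (H l l.+1) (H k k.+1)))
  + (2%:R * h) *:
    \sum_(1 <= k < N.+1) \sum_(k.+1 <= l < N.+1) tens (E l k) (E k l).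

Definition r_jord (xi : F) : tensor sl :=
  - xi *: (wedge (H 1 N) (E 1 N)
           + 2%:R *: \sum_(2 <= k < N) wedge (E 1 k) (E k N)).

Definition mu_std (h : F) : mult (dual sl) :=
  dual_mult (cobracket sl_br (r_std h)).

Definition mu_jord (xi : F) : mult (dual sl) :=
  dual_mult (cobracket sl_br (r_jord xi)).

End SpecialLinear.

Arguments sl_br F N : clear implicits.
Arguments mu_std {F} N h.
Arguments mu_jord {F} N xi.

(* Main.v *)
From HB Require Import structures.
Require Import Defs.
From mathcomp Require Import all_boot all_order all_algebra reals complex.
From mathcomp Require Import ring.
Import GRing.Theory Num.Theory.
Local Open Scope ring_scope.

Set Implicit Arguments.
Unset Strict Implicit.

(** For any [x] in a Lie bialgebra [(g, r)], the cobracket of the r-matrix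
    [x . r] is, on the dual Lie algebra, the coboundary of the transpose of
    [ad x].  Since [E_1N . r_std h] is [h] times the jordanian combination of
    wedges, [r_jord xi] is [(- xi / h) E_1N . r_std h], whence the coboundary
    statement.

    For the Lie property of the standard dual, the trace form identifies
    elements of [sl(N)^*] with traceless matrices; writing [R+ X] for the
    diagonal plus twice the strictly upper part of [X] and [R- = R+ - 2], the
    dual bracket becomes [(h/2)([R+ X, R+ Y] - [R- X, R- Y])].  Both [R+] and
    [R-] carry [([R+ X, R+ Y] - [R- X, R- Y])/2] to the commutator of the
    images, and [R+ - R- = 2], so the Jacobi identity of the commutator is
    inherited. *)

(** * Cocycles and coboundaries attached to an r-matrix *)

Lemma lie_multC (F : fieldType) (V : vectType F) (m : mult V) (x y : V) :
  lie_mult m -> m x y = - m y x.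
Proof.
case=> mxx _; apply/eqP; rewrite -addr_eq0; move: (mxx (x + y)).
by rewrite !linearD /= !add_lfunE !mxx add0r addr0 addrC => /eqP.
Qed.

Section ExtendedAdjoint.
Variables (F : fieldType) (V : vectType F).
Implicit Types (m : mult V) (r t : tensor V) (a b x : V) (f k : dual V).

Lemma tensorBE s t f k : (s - t) f k = s f k - t f k.
Proof. by rewrite !(add_lfunE, opp_lfunE). Qed.

Lemma tensorZE c t f k : (c *: t) f k = c * t f k.
Proof. by rewrite !scale_lfunE. Qed.

Lemma ad2_is_linear m a : linear (ad2 m a).
Proof. by move=> c s t; rewrite /ad2 !tmap_linear scalerDr addrACA. Qed.

HB.instance Definition _ m a :=
  GRing.isLinear.Build F (tensor V) (tensor V) *:%R (ad2 m a) (ad2_is_linear m a).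

(** By the Jacobi identity, [m (m a b)] is the commutator of [m a] and [m b]; the mixed terms, which
    act on both tensor factors, cancel. *)
Lemma ad2_lie m a b t : lie_mult m ->
  ad2 m (m a b) t = ad2 m a (ad2 m b t) - ad2 m b (ad2 m a t).
Proof.
move=> lie_m; have [_ jac] := lie_m.
have adE : m (m a b) = (m a \o m b)%VF - (m b \o m a)%VF.
  apply/lfunP=> c; rewrite !(add_lfunE, opp_lfunE, comp_lfunE) /=.
  have := jac a b c; rewrite (lie_multC c a) // (lie_multC c (m a b)) // linearN.
  by move=> /= /eqP; rewrite subr_eq0 => /eqP <-.
apply/lfunP=> f; apply/lfunP=> k.
rewrite tensorBE !ad2E adE !(comp_lfunDr, comp_lfunNr) !comp_lfunA.
rewrite !linearD !linearN /= !(add_lfunE, opp_lfunE); ring.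
Qed.

Lemma in_wedgeD s t : in_wedge s -> in_wedge t -> in_wedge (s + t).
Proof. by case=> u -> [v ->]; exists (u ++ v); rewrite big_cat. Qed.

Lemma wedge_in_wedge v w : in_wedge (wedge v w : tensor V).
Proof. by exists [:: (v, w)]; rewrite big_seq1. Qed.

(** Since [in_wedge] allows sums without coefficients, a scalar has to be absorbed into one of the
    vectors. *)
Lemma scale_wedge c v w : c *: wedge v w = wedge (c *: v) w :> tensor V.
Proof.
apply/lfunP=> f; apply/lfunP=> k.
have fZ (l : dual V) u : l (c *: u) = c * l u by exact: linearZ.
have wE (v1 v2 : V) : wedge v1 v2 f k = f v1 * k v2 - f v2 * k v1.
  by rewrite /wedge !(add_lfunE, opp_lfunE, tensE).
rewrite !scale_lfunE !wE !fZ -[LHS]/(c * (f v * k w - f w * k v)); ring.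
Qed.

Lemma in_wedgeZ c t : in_wedge t -> in_wedge (c *: t).
Proof.
case=> s ->; exists [seq (c *: p.1, p.2) | p <- s].
by rewrite big_map scaler_sumr; apply: eq_bigr => p _; rewrite scale_wedge.
Qed.

Lemma in_wedge_sum (I : Type) (s : seq I) (P : pred I) (t : I -> tensor V) :
  (forall i, in_wedge (t i)) -> in_wedge (\sum_(i <- s | P i) t i).
Proof.
move=> wt; elim/big_ind: _ => //; last exact: in_wedgeD.
by exists [::]; rewrite big_nil.
Qed.

Lemma ad2_in_wedge m a t : in_wedge t -> in_wedge (ad2 m a t).
Proof.
case=> s ->; rewrite linear_sum /=.
apply: in_wedge_sum => p.
have -> : ad2 m a (wedge p.1 p.2) = wedge (m a p.1) p.2 + wedge p.1 (m a p.2).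
  rewrite linearB /= !ad2_tens /wedge.
  by rewrite opprD [- tens _ _ - _]addrC addrACA.
by apply: in_wedgeD; exact: wedge_in_wedge.
Qed.

(** [cobracket m r] is the coboundary of the 0-cochain [r], so its cocycle identity is the
    representation property [ad2_lie]. *)
Lemma cocycle1_cobracket m r :
  lie_mult m -> in_wedge r -> cocycle1 m (cobracket m r).
Proof.
move=> lie_m wr; split=> [a|a b]; rewrite !cobracketE.
  exact: ad2_in_wedge.
exact: ad2_lie.
Qed.

(* Infinitesimally, the r-matrix [ad2 m x r] is the image of [r] under the
   automorphism [exp (ad x)]; on the dual this is the coboundary of the
   transpose of [ad x]. *)
Lemma coboundary2_ad2 m r x c :
  lie_mult m -> lie_mult (dual_mult (cobracket m r)) ->
  coboundary2 (dual_mult (cobracket m r))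
    (dual_mult (cobracket m (c *: ad2 m x r))).
Proof.
move=> lie_m lie_d; set d := dual_mult _.
exists (linfun (fun f : dual V => c *: (f \o m x)%VF : dual V)).
have phiE : linfun (fun f : dual V => c *: (f \o m x)%VF : dual V)
    =1 (fun f : dual V => c *: (f \o m x)%VF).
  apply: linfun_linE => b f k.
  by rewrite comp_lfunDl -comp_lfunZl scalerDr !scalerA mulrC.
move=> f k; apply/lfunP=> a.
rewrite !phiE (lie_multC k) // opprK.
rewrite !(add_lfunE, opp_lfunE, scale_lfunE, comp_lfunE) !dual_multE !cobracketE.
have -> : ad2 m a (c *: ad2 m x r) = c *: (ad2 m x (ad2 m a r) - ad2 m (m x a) r).
  by rewrite linearZ /= ad2_lie // subKr.
rewrite tensorZE tensorBE [ad2 m x _ f k]ad2E !linearZ /= !scale_lfunE.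
by rewrite -[RHS]/(c * _ + c * _ + c * _) mulrBr mulrDr mulrN [c * _ + c * _]addrC.
Qed.

End ExtendedAdjoint.

(** * Partial summation for the Cartan part of the standard r-matrix *)

Section CartanSum.
Variable R : comPzRingType.
Implicit Types (x y : nat -> R) (c : R).

Lemma sum_mul_consecutive_diff x M :
  \sum_(1 <= k < M.+1) k%:R * (x k - x k.+1) =
    \sum_(1 <= i < M.+2) x i - M.+1%:R * x M.+1.
Proof.
elim: M => [|M IH]; first by rewrite big_nil big_nat1; ring.
rewrite big_nat_recr //= IH [in RHS]big_nat_recr //= -!natr1; ring.
Qed.

(* Stated with an indeterminate [c] in place of [N] and for arbitrary partial
   sums, in order that it can be proved by induction on [M]. *)
Lemma cartan_sum_partial c x y M :
  let P z := \sum_(1 <= i < M.+2) z i in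
  \sum_(1 <= k < M.+1) k%:R * (c - k%:R) * ((x k - x k.+1) * (y k - y k.+1))
  + \sum_(1 <= l < M.+1) (c - l%:R) *
      ((y l - y l.+1) * (\sum_(1 <= k < l) k%:R * (x k - x k.+1))
       + (x l - x l.+1) * (\sum_(1 <= k < l) k%:R * (y k - y k.+1)))
  = c * P (fun i => x i * y i) - P x * P y
    + (M.+1%:R - c) *
        (P x * y M.+1 + x M.+1 * P y - M.+1%:R * (x M.+1 * y M.+1)).
Proof.
elim: M => [|M IH] /=; first by rewrite !big_nil !big_nat1; ring.
rewrite big_nat_recr //= [X in _ + X = _]big_nat_recr //= addrACA IH !sum_mul_consecutive_diff.
rewrite ![\sum_(1 <= _ < M.+3) _]big_nat_recr //= -!natr1; ring.
Qed.

End CartanSum.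

(** * Triangular splitting of matrices and the bracket it induces *)

Section TriangularSplitting.
Variables (F : numFieldType) (N : nat).
Implicit Types X Y Z A B : 'M[F]_N.

Definition mxcomm A B := A *m B - B *m A.

Lemma mxcommDl A B Z : mxcomm (A + B) Z = mxcomm A Z + mxcomm B Z.
Proof. by rewrite /mxcomm mulmxDl mulmxDr opprD addrACA. Qed.

Lemma mxcommNl A Z : mxcomm (- A) Z = - mxcomm A Z.
Proof. by rewrite /mxcomm mulNmx mulmxN opprB opprK addrC. Qed.

Lemma mxcommC A B : mxcomm A B = - mxcomm B A.
Proof. by rewrite opprB. Qed.

Lemma mxcommZr c A Z : mxcomm Z (c *: A) = c *: mxcomm Z A.
Proof. by rewrite /mxcomm -scalemxAl -scalemxAr -scalerBr. Qed.

Lemma mxcomm_jacobi X Y Z :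
  mxcomm X (mxcomm Y Z) + mxcomm Y (mxcomm Z X) + mxcomm Z (mxcomm X Y) = 0.
Proof.
rewrite /mxcomm !(mulmxBr, mulmxBl) !mulmxA.
set a := _ *m _ *m _; set b := _ *m _ *m _; set c := _ *m _ *m _.
set d := _ *m _ *m _; set e := _ *m _ *m _; set f := _ *m _ *m _.
clearbody a b c d e f.
by apply/matrixP=> i j; rewrite !mxE; ring.
Qed.

Lemma mxtrace_mxcomm A B : \tr (mxcomm A B) = 0.
Proof. by rewrite linearB /= mxtrace_mulC subrr. Qed.

(** At an entry with [j <= i], only the term [k = i = j] of each product can survive, and there the
    scalars commute. *)
Lemma mxcomm_triu A B :
  (forall i j : 'I_N, (j < i)%N -> A i j = 0) ->
  (forall i j : 'I_N, (j < i)%N -> B i j = 0) ->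
  forall i j : 'I_N, (j <= i)%N -> mxcomm A B i j = 0.
Proof.
move=> A0 B0 i j ji; rewrite !mxE -sumrB big1 // => k _.
have [ki|ik] := ltnP k i; first by rewrite (A0 i k) // (B0 i k) // !mul0r subrr.
have [jk|kj] := ltnP j k; first by rewrite (A0 k j) // (B0 k j) // !mulr0 subrr.
have <- : i = k by apply/val_inj/eqP; rewrite eqn_leq ik (leq_trans kj).
have <- : i = j by apply/val_inj/eqP; rewrite eqn_leq ji (leq_trans ik).
by rewrite mulrC subrr.
Qed.

Lemma mxcomm_tril A B :
  (forall i j : 'I_N, (i < j)%N -> A i j = 0) ->
  (forall i j : 'I_N, (i < j)%N -> B i j = 0) ->
  forall i j : 'I_N, (i <= j)%N -> mxcomm A B i j = 0.
Proof.
move=> A0 B0 i j ij.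
have -> : mxcomm A B = (mxcomm B^T A^T)^T.
  by rewrite linearB /= !trmx_mul !trmxK.
by rewrite mxE mxcomm_triu // => k l lk; rewrite mxE (A0, B0).
Qed.

(** The factor is 2 above the diagonal, 1 on it and 0 below: this is R+ = 1 + R, where R multiplies
    the three parts by 1, 0 and -1. *)
Definition upper_proj X : 'M[F]_N :=
  \matrix_(i, j) (((i <= j) + (i < j))%N%:R * X i j).

Definition lower_proj X : 'M[F]_N := upper_proj X - X *+ 2.

(** In terms of R this is [R X, Y] + [X, R Y]. *)
Definition std_bracket X Y : 'M[F]_N :=
  mxcomm (upper_proj X) Y + mxcomm X (upper_proj Y) - mxcomm X Y *+ 2.

Lemma upper_proj_is_linear : linear upper_proj.
Proof. by move=> c X Y; apply/matrixP=> i j; rewrite !mxE; ring. Qed.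

HB.instance Definition _ :=
  GRing.isLinear.Build F 'M[F]_N 'M[F]_N *:%R upper_proj upper_proj_is_linear.

Lemma std_bracket2 X Y :
  std_bracket X Y *+ 2 =
    mxcomm (upper_proj X) (upper_proj Y) - mxcomm (lower_proj X) (lower_proj Y).
Proof.
rewrite /std_bracket /lower_proj /mxcomm !(mulmxBr, mulmxBl, mulr2n, mulmxDl, mulmxDr).
by apply/matrixP=> i j; rewrite 2!mxE [in RHS]mxE; rewrite !mxE; ring.
Qed.

Lemma upper_proj_triu X (i j : 'I_N) : (j < i)%N -> upper_proj X i j = 0.
Proof. by move=> ji; rewrite mxE [(i <= j)%N]leqNgt ji ltnNge (ltnW ji) mul0r. Qed.

Lemma lower_proj_tril X (i j : 'I_N) : (i < j)%N -> lower_proj X i j = 0.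
Proof. by move=> ij; rewrite !mxE ij ltnW //=; ring. Qed.

Lemma mulr2n_inj A B : A *+ 2 = B *+ 2 -> A = B.
Proof.
move=> /matrixP AB; apply/matrixP=> i j; move: (AB i j); rewrite !mulmxnE.
exact: pmulrnI.
Qed.

(** In [std_bracket2] the first commutator is strictly upper and the second strictly lower
    triangular; R+ doubles the one and kills the other. *)
Lemma upper_proj_bracket X Y :
  upper_proj (std_bracket X Y) = mxcomm (upper_proj X) (upper_proj Y).
Proof.
apply: mulr2n_inj; rewrite -linearMn /= std_bracket2.
apply/matrixP=> i j; rewrite !mulmxnE [LHS]mxE [in LHS]mxE [X in _ + X]mxE.
have [ij|ji|/val_inj ij] := ltngtP i j.
- by rewrite [X in _ - X]mxcomm_tril ?(ltnW ij) ?subr0 ?mulr_natl //; exact: lower_proj_tril.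
- rewrite mxcomm_triu ?(ltnW ji) ?mul0r ?mul0rn //; exact: upper_proj_triu.
- rewrite ij mxcomm_triu // ?mxcomm_tril // ?subr0 ?mulr0 ?mul0rn //.
  + exact: lower_proj_tril.
  + exact: lower_proj_tril.
  + exact: upper_proj_triu.
  + exact: upper_proj_triu.
Qed.

Lemma lower_proj_bracket X Y :
  lower_proj (std_bracket X Y) = mxcomm (lower_proj X) (lower_proj Y).
Proof. by rewrite {1}/lower_proj upper_proj_bracket std_bracket2 opprB addrC subrK. Qed.

(* Twice the Jacobiator of the bracket is the difference of the commutator
   Jacobiators of the images under the two projections. *)
Lemma std_bracket_jacobi X Y Z :
  std_bracket X (std_bracket Y Z) + std_bracket Y (std_bracket Z X)
    + std_bracket Z (std_bracket X Y) = 0.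
Proof.
apply: mulr2n_inj; rewrite [LHS]mulrnDl [X in X + _ = _]mulrnDl !std_bracket2.
rewrite !upper_proj_bracket !lower_proj_bracket.
by rewrite [X in X + _]addrACA -opprD addrACA -opprD !mxcomm_jacobi subrr mul0rn.
Qed.

Lemma std_bracketZr c X Y : std_bracket X (c *: Y) = c *: std_bracket X Y.
Proof.
rewrite /std_bracket linearZ /= !mxcommZr.
by rewrite [RHS]scalerBr [c *: (mxcomm _ _ + _)]scalerDr scalerMnr.
Qed.

Lemma std_bracketxx X : std_bracket X X = 0.
Proof.
by rewrite /std_bracket /mxcomm !subrr mul0rn subr0 addrC addrA subrK subrr.
Qed.

Lemma mxtrace_std_bracket X Y : \tr (std_bracket X Y) = 0.
Proof. by rewrite linearB linearD linearMn /= !mxtrace_mxcomm mul0rn subr0 addr0. Qed.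

End TriangularSplitting.

(** Up to the factor [N], the coefficients form the inverse Cartan matrix of type A_{N-1}, whence
    the diagonal trace form. In [cartan_sum_partial], taking [c = M + 1 = N] and using the vanishing
    sums leaves only the sum of products. *)
Lemma cartan_sum (R : comPzRingType) (x y : nat -> R) (N : nat) :
  (0 < N)%N -> \sum_(1 <= i < N.+1) x i = 0 -> \sum_(1 <= i < N.+1) y i = 0 ->
  \sum_(1 <= k < N) (k * (N - k))%:R * ((x k - x k.+1) * (y k - y k.+1))
  + \sum_(1 <= k < N) \sum_(k.+1 <= l < N) ((N - l) * k)%:R *
      ((x k - x k.+1) * (y l - y l.+1) + (x l - x l.+1) * (y k - y k.+1))
  = N%:R * \sum_(1 <= i < N.+1) x i * y i.
Proof.
case: N => // M _ x0 y0; have := cartan_sum_partial M.+1%:R x y M.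
rewrite /= x0 y0 subrr !mul0r subr0 addr0 => <-; congr (_ + _).
  by rewrite !big_nat; apply: eq_bigr => k /andP[_ kM]; rewrite natrM natrB // ltnW.
(* The inner range becomes a filter, so that the sums can be exchanged and the larger index becomes
   the outer one. *)
under eq_bigr => k _ do rewrite (big_nat_widenl _ 1%N) //.
rewrite (exchange_big_dep xpredT) //= !big_nat; apply: eq_bigr => l /andP[_ lM].
rewrite -(natrB _ (ltnW lM)) !(big_nat_widen 1 l M.+1) ?(ltnW lM) //=.
rewrite !mulr_sumr -big_split mulr_sumr; apply: eq_bigr => k _; rewrite natrM /=; ring.
Qed.

(** * The standard dual Lie algebra in terms of traceless matrices *)

Section TraceForm.
Variables (F : numFieldType) (N : nat).
Implicit Types (X Y Z A : 'M[F]_N) (f k : dual (sl F N)) (a : sl F N).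

Lemma mxtrace_mul_delta X (i j : 'I_N) : \tr (X *m delta_mx i j) = X j i.
Proof.
rewrite /mxtrace (bigD1 j) //= big1 => [|l lj]; rewrite !mxE.
  by rewrite addr0 (bigD1 i) //= big1 ?addr0 => [|m mi];
    rewrite !mxE ?eqxx ?mulr1 // (negPf mi) mulr0.
by rewrite big1 // => m _; rewrite mxE (negPf lj) andbF mulr0.
Qed.

Lemma mxtrace_mul_Emx X (i j : 'I_N) : \tr (X *m Emx F N i.+1 j.+1) = X j i.
Proof.
rewrite -mxtrace_mul_delta; congr (\tr (_ *m _)).
by apply/matrixP=> l m; rewrite !mxE !eqSS.
Qed.

Lemma mxtrace_mxcomm_mul X A Z :
  \tr (mxcomm X A *m Z) = \tr (mxcomm Z X *m A).
Proof.
rewrite !mulmxBl !linearB /=; congr (_ - _).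
  by rewrite mxtrace_mulC mulmxA.
by rewrite -!mulmxA mxtrace_mulC !mulmxA.
Qed.

(** The trace form pairs the entry (i, j) with (j, i), so R is skew and the adjoint of 1 + R is 1 -
    R = 2 - R+. *)
Lemma mxtrace_upper_proj X Y :
  \tr (upper_proj X *m Y) = \tr (X *m (Y *+ 2 - upper_proj Y)).
Proof.
apply: eq_bigr => i _; rewrite !mxE; apply: eq_bigr => j _; rewrite !mxE.
by have [//|//|] := ltngtP i j => /= _; ring.
Qed.

(** Tracelessness of [X] supplies the zero-sum condition on diagonals in [cartan_sum]. *)
Definition trace_dual X f := \tr X = 0 /\ forall a, f a = \tr (X *m vsval a).

Lemma trace_dual_ex f : (0 < N)%N -> exists X, trace_dual X f.
Proof.
(* Diagonal units are not traceless; on them only the linearity of [to_sl] is used. The scalar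
   matrix subtracted from [X0] restores trace zero and pairs to zero with [sl]. *)
move=> N0; pose X0 := \matrix_(i < N, j < N) (f (to_sl (delta_mx j i)) : F).
exists (X0 - (\tr X0 / N%:R)%:M); split=> [|a].
  by rewrite linearB /= mxtrace_scalar -[X in _ - X]mulr_natr divfK ?subrr // pnatr_eq0 -lt0n.
rewrite mulmxBl mul_scalar_mx linearB linearZ /=.
have /eqP-> : \tr (vsval a) == 0 by rewrite -mem_sl; exact: subvsP.
rewrite mulr0 subr0 -{1}[a]vsvalK {1}[vsval a]matrix_sum_delta.
transitivity (\sum_i \sum_j vsval a i j * f (to_sl (delta_mx i j))).
  rewrite [vsproj _ _]linear_sum linear_sum; apply: eq_bigr => i _ /=.
  rewrite [vsproj _ _]linear_sum linear_sum; apply: eq_bigr => j _ /=.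
  by rewrite [vsproj _ _]linearZ linearZ.
rewrite exchange_big; apply: eq_bigr => j _.
by rewrite mxE; apply: eq_bigr => i _; rewrite mxE mulrC.
Qed.

Lemma trace_dual0 f : trace_dual 0 f -> f = 0.
Proof. by case=> _ f0; apply/lfunP=> a; rewrite f0 mul0mx linear0 lfunE. Qed.

Lemma trace_dualD X Y f k :
  trace_dual X f -> trace_dual Y k -> trace_dual (X + Y) (f + k).
Proof.
move=> [X0 fX] [Y0 kY]; split=> [|a]; first by rewrite linearD /= X0 Y0 addr0.
by rewrite add_lfunE fX kY mulmxDl linearD.
Qed.

Lemma trace_dual_br X f a : trace_dual X f ->
  trace_dual (mxcomm X (vsval a)) (f \o sl_br F N a)%VF.
Proof.
case=> _ fX; split=> [|b]; first exact: mxtrace_mxcomm.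
rewrite comp_lfunE fX sl_brE.
rewrite mulmxBr mulmxBl !linearB /= !mulmxA; congr (_ - _).
by rewrite [in LHS]mxtrace_mulC mulmxA.
Qed.

Lemma trace_dual_H X f i j : trace_dual X f ->
  (0 < i <= N)%N -> (0 < j <= N)%N ->
  f (H F N i j) = \tr (X *m Emx F N i i) - \tr (X *m Emx F N j j).
Proof. by move=> [_ fX] iN jN; rewrite fX H_val // mulmxBr linearB. Qed.

Lemma trace_dual_E X f i j : trace_dual X f -> i != j ->
  f (E F N i j) = \tr (X *m Emx F N i j).
Proof. by move=> [_ fX] ij; rewrite fX E_val. Qed.

Lemma tensorDE (s t : tensor (sl F N)) f k : (s + t) f k = s f k + t f k.
Proof. by rewrite !add_lfunE. Qed.

Lemma tensor_sumE (I : Type) (s : seq I) (P : pred I) (t : I -> tensor (sl F N)) f k :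
  (\sum_(i <- s | P i) t i) f k = \sum_(i <- s | P i) t i f k.
Proof. by rewrite !sum_lfunE. Qed.

(** The Cartan terms give the diagonal pairing by [cartan_sum]; the root terms pair X_kl with Y_lk
    for k < l, with weight 2, as R+ does. *)
Lemma r_stdE (h : F) X Y f k : (0 < N)%N -> trace_dual X f -> trace_dual Y k ->
  r_std N h f k = h * \tr (upper_proj X *m Y).
Proof.
move=> N0 fX kY.
pose x i := \tr (X *m Emx F N i i); pose y i := \tr (Y *m Emx F N i i).
have tr_sum Z : \tr Z = \sum_(1 <= i < N.+1) \tr (Z *m Emx F N i i).
  by rewrite big_add1 /= big_mkord; apply: eq_bigr => i _; rewrite mxtrace_mul_Emx.
have sx : \sum_(1 <= i < N.+1) x i = 0 by rewrite -tr_sum; case: fX.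
have sy : \sum_(1 <= i < N.+1) y i = 0 by rewrite -tr_sum; case: kY.
have fH i : (0 < i)%N -> (i < N)%N -> f (H F N i i.+1) = x i - x i.+1.
  by move=> i0 iN; rewrite (trace_dual_H fX) // i0 ltnW.
have kH i : (0 < i)%N -> (i < N)%N -> k (H F N i i.+1) = y i - y i.+1.
  by move=> i0 iN; rewrite (trace_dual_H kY) // i0 ltnW.
rewrite /r_std tensorDE !tensorZE tensorDE !tensor_sumE.
set S1 := \sum_(1 <= i < N) _; set S2 := \sum_(1 <= i < N) _.
set S3 := \sum_(1 <= i < N.+1) _.
have -> : S1 + S2 = N%:R * \sum_i X i i * Y i i.
  transitivity (N%:R * \sum_(1 <= i < N.+1) x i * y i); last first.
    congr (_ * _); rewrite big_add1 /= big_mkord; apply: eq_bigr => i _.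
    by rewrite /x /y !mxtrace_mul_Emx.
  rewrite -cartan_sum //; congr (_ + _).
    rewrite /S1 !big_nat; apply: eq_bigr => i /andP[i0 iN].
    by rewrite tensorZE tensE fH // kH.
  rewrite /S2 !big_nat; apply: eq_bigr => i /andP[i0 iN].
  rewrite tensor_sumE !big_nat; apply: eq_bigr => j /andP[ij jN].
  by rewrite tensorZE tensorDE !tensE !fH ?kH // (leq_trans _ ij).
have -> : S3 = \sum_(i < N) \sum_(j < N | (i < j)%N) X i j * Y j i.
  rewrite /S3 big_add1 /= big_mkord; apply: eq_bigr => i _.
  rewrite tensor_sumE big_add1 /= (big_nat_widenl _ 0%N) // big_mkord /=.
  apply: eq_bigr => j ij; rewrite tensE (trace_dual_E fX) ?(trace_dual_E kY).
  - by rewrite !mxtrace_mul_Emx.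
  - by rewrite eqSS neq_ltn ij.
  - by rewrite eqSS neq_ltn ij orbT.
have -> : \tr (upper_proj X *m Y) =
    \sum_i X i i * Y i i + 2 * \sum_(i < N) \sum_(j < N | (i < j)%N) X i j * Y j i.
  rewrite mulr_sumr -big_split; apply: eq_bigr => i _ /=.
  rewrite mxE (bigD1 i) //= [in RHS]mulr_sumr [in RHS]big_mkcond /=.
  rewrite [in RHS](bigD1 i) //= ltnn add0r !mxE leqnn ltnn mul1r; congr (_ + _).
  apply: eq_bigr => j ji; rewrite mxE.
  have [ij|ij|/val_inj ij] := ltngtP i j; rewrite ?mul0r //=; first by ring.
  by rewrite ij eqxx in ji.
have : N%:R != 0 :> F by rewrite pnatr_eq0 -lt0n.
by move=> Nn0; field.
Qed.

(** The pairing with [a] is [h] times tr(R+ [X, a] Y) + tr(R+ X [Y, a]); the adjoint of R+ and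
    cyclicity of the trace isolate [a]. *)
Lemma trace_dual_mu_std (h : F) X Y f k : (0 < N)%N ->
  trace_dual X f -> trace_dual Y k ->
  trace_dual (h *: std_bracket X Y) (mu_std N h f k).
Proof.
move=> N0 fX kY; split=> [|a]; first by rewrite linearZ /= mxtrace_std_bracket mulr0.
rewrite dual_multE cobracketE ad2E.
rewrite (r_stdE h N0 (trace_dual_br a fX) kY) (r_stdE h N0 fX (trace_dual_br a kY)).
rewrite mxtrace_upper_proj !(mxtrace_mulC _ (mxcomm _ _)) (mxtrace_mxcomm_mul X).
rewrite (mxtrace_mxcomm_mul Y).
rewrite -mulrDr -linearD /= -mulmxDl -scalemxAl linearZ /=; congr (_ * \tr (_ *m _)).
rewrite mxcommDl mxcommNl (mxcommC (upper_proj Y)) opprK mulr2n mxcommDl.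
by rewrite (mxcommC Y X) -opprD -mulr2n addrC [- _ + _]addrC addrA.
Qed.

Lemma mu_std_lie (h : F) : (0 < N)%N -> lie_mult (mu_std N h).
Proof.
move=> N0; split=> [f|f g k].
  have [X fX] := trace_dual_ex f N0; apply: trace_dual0.
  by have := trace_dual_mu_std h N0 fX fX; rewrite std_bracketxx scaler0.
have [X fX] := trace_dual_ex f N0; have [Y gY] := trace_dual_ex g N0.
have [Z kZ] := trace_dual_ex k N0; apply: trace_dual0.
have muP := trace_dual_mu_std h N0.
have := trace_dualD (trace_dualD (muP _ _ _ _ fX (muP _ _ _ _ gY kZ))
  (muP _ _ _ _ gY (muP _ _ _ _ kZ fX))) (muP _ _ _ _ kZ (muP _ _ _ _ fX gY)).
by rewrite !std_bracketZr -!scalerDr std_bracket_jacobi !scaler0.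
Qed.

End TraceForm.

(** * The jordanian r-matrix from the action of E_1N on the standard one *)

Lemma std_bracket_corner (F : numFieldType) (n : nat) (X Y : 'M[F]_n.+2) :
  std_bracket X Y ord_max ord0 =
    (X ord0 ord0 - X ord_max ord_max) * Y ord_max ord0
    - X ord_max ord0 * (Y ord0 ord0 - Y ord_max ord_max)
    + 2 * \sum_(i < n)
        (X (lift ord0 (widen_ord (leqnSn n) i)) ord0
           * Y ord_max (lift ord0 (widen_ord (leqnSn n) i))
         - X ord_max (lift ord0 (widen_ord (leqnSn n) i))
           * Y (lift ord0 (widen_ord (leqnSn n) i)) ord0).
Proof.
(* [m] enumerates the indices strictly between the first and the last. *)
pose m i : 'I_n.+2 := lift ord0 (widen_ord (leqnSn n) i).
(* The last row and the first column of an upper triangular matrix vanish off the diagonal, so each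
   product below has a single term. *)
have up_r Z W : (upper_proj Z *m W) ord_max ord0 = Z ord_max ord_max * W ord_max ord0.
  rewrite mxE (bigD1 ord_max) //= big1 ?addr0 => [|i ni].
    by rewrite mxE leqnn ltnn mul1r.
  rewrite upper_proj_triu ?mul0r // ltn_neqAle -ltnS ltn_ord andbT.
  by apply: contraNneq ni => ni; apply/eqP/val_inj.
have up_l Z W : (Z *m upper_proj W) ord_max ord0 = Z ord_max ord0 * W ord0 ord0.
  rewrite mxE (bigD1 ord0) //= big1 ?addr0 => [|i ni].
    by rewrite mxE leqnn ltnn mul1r.
  by rewrite upper_proj_triu ?mulr0 // lt0n.
have mulE Z W : (Z *m W) ord_max ord0 = Z ord_max ord0 * W ord0 ord0
    + \sum_(i < n) Z ord_max (m i) * W (m i) ord0 + Z ord_max ord_max * W ord_max ord0.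
  rewrite mxE big_ord_recl big_ord_recr addrA /=.
  by have -> : lift ord0 ord_max = ord_max :> 'I_n.+2 by apply/val_inj.
have sumE : \sum_(i < n) (X (m i) ord0 * Y ord_max (m i) - X ord_max (m i) * Y (m i) ord0)
  = \sum_(i < n) Y ord_max (m i) * X (m i) ord0 - \sum_(i < n) X ord_max (m i) * Y (m i) ord0.
  by rewrite -sumrB; apply: eq_bigr => i _; rewrite [X (m i) _ * _]mulrC.
have entB (A B : 'M[F]_n.+2) i j : (A - B) i j = A i j - B i j by rewrite !mxE.
rewrite -/(m _) in sumE *; rewrite sumE.
rewrite /std_bracket entB mxE mulmxnE /mxcomm !entB !up_r !up_l !mulE; ring.
Qed.

(** Evaluated on [f] and [k], the left side is the dual bracket paired with E_1N, that is, [h] times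
    a corner entry of [std_bracket]; its terms are the values of the wedges. *)
Lemma ad2_std_corner (F : numFieldType) (N : nat) (h : F) : (2 <= N)%N ->
  ad2 (sl_br F N) (E F N 1 N) (r_std N h) =
    h *: (wedge (H F N 1 N) (E F N 1 N)
          + 2%:R *: \sum_(2 <= k < N) wedge (E F N 1 k) (E F N k N)).
Proof.
case: N => [|[|n]] // _; apply/lfunP=> f; apply/lfunP=> k.
have [X fX] := trace_dual_ex f (ltn0Sn n.+1); have [Y kY] := trace_dual_ex k (ltn0Sn n.+1).
have [_ muXY] := trace_dual_mu_std h (ltn0Sn n.+1) fX kY.
have tr0m Z : \tr (Z *m Emx F n.+2 1 n.+2) = Z ord_max ord0.
  exact: (mxtrace_mul_Emx _ ord0 ord_max).
have := muXY (E F n.+2 1 n.+2); rewrite dual_multE cobracketE => ->.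
rewrite E_val // -scalemxAl linearZ /= tr0m.
rewrite std_bracket_corner tensorZE tensorDE tensorZE tensor_sumE.
have wedgeE v w : wedge v w f k = f v * k w - f w * k v.
  by rewrite tensorBE !tensE.
have tr0 Z : \tr (Z *m Emx F n.+2 1 1) = Z ord0 ord0.
  exact: (mxtrace_mul_Emx _ ord0 ord0).
have trm Z : \tr (Z *m Emx F n.+2 n.+2 n.+2) = Z ord_max ord_max.
  exact: (mxtrace_mul_Emx _ ord_max ord_max).
rewrite wedgeE (trace_dual_H fX) ?(trace_dual_H kY) ?leqnn // !tr0 !trm.
rewrite !(trace_dual_E fX, trace_dual_E kY) // !tr0m.
congr (_ * (_ + _ * _)).
(* The index k = i + 2, counted from 1, is the ordinal of value i + 1. *)
rewrite !big_add1 /= big_mkord; apply: eq_bigr => i _.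
rewrite wedgeE !(trace_dual_E fX) ?(trace_dual_E kY) ?neq_ltn ?ltnS ?ltn_ord //.
rewrite (mxtrace_mul_Emx X ord0 (lift ord0 (widen_ord (leqnSn n) i))).
rewrite (mxtrace_mul_Emx Y ord0 (lift ord0 (widen_ord (leqnSn n) i))).
rewrite (mxtrace_mul_Emx X (lift ord0 (widen_ord (leqnSn n) i)) ord_max).
by rewrite (mxtrace_mul_Emx Y (lift ord0 (widen_ord (leqnSn n) i)) ord_max).
Qed.

Lemma r_jord_in_wedge (F : fieldType) (N : nat) (xi : F) : in_wedge (r_jord N xi).
Proof.
apply/in_wedgeZ/in_wedgeD; first exact: wedge_in_wedge.
by apply/in_wedgeZ/in_wedge_sum => k; exact: wedge_in_wedge.
Qed.

Theorem mainTheorem6 (R : realType) (N : nat) (h xi : R[i]) :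
  (2 <= N)%N -> h != 0 ->
  [/\ lie_mult (mu_std N h),
      cocycle1 (sl_br R[i] N) (codual (mu_jord N xi))
    & coboundary2 (mu_std N h) (mu_jord N xi)].
Proof.
move=> N2 h0; have std_lie := mu_std_lie h (ltnW N2).
have sl_lie := sl_br_lie R[i] N; split=> //.
  by rewrite dual_multK; apply: cocycle1_cobracket => //; exact: r_jord_in_wedge.
rewrite /mu_jord.
(* Dividing by [h] cancels the factor [h] in [ad2_std_corner]. *)
have -> : r_jord N xi = (- xi / h) *: ad2 (sl_br R[i] N) (E _ N 1 N) (r_std N h).
  by rewrite ad2_std_corner // scalerA divfK.
exact: coboundary2_ad2.
Qed.
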